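(* Let $\{\mu_n\}_{n\geqslant0}$ be a sequence of real numbers such that $\det G_n\neq0$ for all $n\geqslant0$, where $G_n=[\mu_{i+j}]_{i,j=0}^n$. For $n\geqslant0$, let $S_n^{-1}\,H_n\,S_n^{-\top}$ be the Cholesky factorization of $G_n$ and let $\bar s_{n,0},\bar s_{n,1},\dots,\bar s_{n,n}$ denote the columns of $S_n^{\top}$. Then $\{\mu_n\}_{n\geqslant0}$ is classical if and only if there are real numbers $a,b,c$ satisfying $|a|+|b|+|c|>0$ such that, for every $n\geqslant0$, the set $\{\bar s_{n,0}^{(1)},\dots,\bar s_{n,n}^{(1)}\}$ of vectors in $\mathbb{R}^{n+1}$ with $$\bar s_{n,j}^{(1)}=\frac{1}{j+1}\,N_{n+1}\,\bar s_{n+1,j+1},\quad 0\leqslant j\leqslant n,$$ constitutes an orthogonal basis for $\mathbb{R}^{n+1}$ with respect to the bilinear form associated with $\{\sigma_n\}_{n\geqslant0}$, where $$\sigma_n=a\,\mu_{n+2}+b\,\mu_{n+1}+c\,\mu_n,\quad n\geqslant0.$$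
   Context: A sequence of real numbers $\{\mu_n\}_{n\geqslant 0}$ with $\mu_0\neq0$ is pre-classical if there are real numbers $a,b,c,d,e$ with $|a|+|b|+|c|>0$ and $n\,a+d\neq0$ for all $n\geqslant0$, such that $(n\,a+d)\,\mu_{n+1}+(n\,b+e)\,\mu_n+n\,c\,\mu_{n-1}=0$ for all $n\geqslant0$ (with $\mu_n=0$ for $n<0$). It is classical if moreover $\det G_n\neq0$ for all $n\geqslant0$. The Cholesky factorization $G_n=S_n^{-1}H_nS_n^{-\top}$ is the unique one with $S_n$ (equivalently $S_n^{-1}$) unit lower triangular and $H_n$ nonsingular diagonal; $S_n^{-\top}=(S_n^{-1})^{\top}$. $N_{n}$, $n\geqslant 1$, is the $n\times(n+1)$ matrix (rows and columns indexed from $0$) with $(N_n)_{k,k+1}=k+1$ for $0\leqslant k\leqslant n-1$ and zeros elsewhere. The bilinear form on $\mathbb{R}^{n+1}$ associated with a sequence $\{\sigma_n\}_{n\geqslant0}$ is $\mathfrak{B}^{(1)}_n(\bar u,\bar v)=\bar u^{\top}G_n^{(1)}\bar v$ with $G_n^{(1)}=[\sigma_{i+j}]_{i,j=0}^n$. A basis $\bar w_0,\dots,\bar w_n$ is orthogonal with respect to a symmetric bilinear form $\mathfrak{B}$ if $\mathfrak{B}(\bar w_i,\bar w_j)=0$ for $i\neq j$ and $\mathfrak{B}(\bar w_i,\bar w_i)\neq0$ for all $i$. *)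

(* Defs.v *)
From HB Require Import structures.
From mathcomp Require Import all_boot all_order all_algebra.
From mathcomp Require Import reals.

Set Implicit Arguments.
Unset Strict Implicit.
Unset Printing Implicit Defensive.

Import Order.TTheory GRing.Theory Num.Theory.
Local Open Scope ring_scope.

Definition hankel (R : realType) (mu : nat -> R) (n : nat) : 'M[R]_n.+1 :=
  \matrix_(i, j) mu (i + j)%N.

(* mu_(n-1), with the convention mu_(-1) = 0. *)
Definition pred_term (R : realType) (mu : nat -> R) (n : nat) : R :=
  if n is m.+1 then mu m else 0.

Definition pre_classical (R : realType) (mu : nat -> R) : Prop :=
  mu 0%N != 0 /\
  exists a b c d e : R,
    [/\ 0 < `|a| + `|b| + `|c|,
        forall n : nat, n%:R * a + d != 0
      & forall n : nat,
          (n%:R * a + d) * mu n.+1 + (n%:R * b + e) * mu n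
            + n%:R * c * pred_term mu n = 0].

Definition classical (R : realType) (mu : nat -> R) : Prop :=
  pre_classical mu /\ forall n : nat, \det (hankel mu n) != 0.

(* [is_trig_mx] means lower triangular. A unit lower triangular S is
   invertible, so [invmx S] is its genuine inverse. *)
Definition unit_lower_triangular (R : realType) (m : nat) (S : 'M[R]_m) : Prop :=
  is_trig_mx S /\ forall i : 'I_m, S i i = 1.

Definition cholesky (R : realType) (m : nat) (G S H : 'M[R]_m) : Prop :=
  [/\ unit_lower_triangular S,
      is_diag_mx H,
      H \in unitmx
    & G = invmx S *m H *m (invmx S)^T].

Definition Nmx (R : realType) (n : nat) : 'M[R]_(n, n.+1) :=
  \matrix_(k, l) (if l == k.+1 :> nat then k.+1%:R else 0).

Definition hankel_form (R : realType) (sigma : nat -> R) (n : nat)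
    (u v : 'cV[R]_n.+1) : R :=
  (u^T *m hankel sigma n *m v) 0 0.

Definition orthogonal_basis (R : realType) (m : nat)
    (B : 'cV[R]_m -> 'cV[R]_m -> R) (w : 'I_m -> 'cV[R]_m) : Prop :=
  [/\ basis_of {:'cV[R]_m} [tuple w i | i < m],
      forall i j : 'I_m, i != j -> B (w i) (w j) = 0
    & forall i : 'I_m, B (w i) (w i) != 0].

(* (1 / (j + 1)) N_(n+1) s_(n+1,j+1), where s_(n+1,j+1) is column j + 1 of the
   transpose of S_(n+1); [lift ord0 j] is j + 1 as an index below n + 2. *)
Definition s1 (R : realType) (S : forall n : nat, 'M[R]_n.+1) (n : nat)
    (j : 'I_n.+1) : 'cV[R]_n.+1 :=
  (j.+1%:R)^-1 *: (Nmx R n.+1 *m col (lift ord0 j) (S n.+1)^T).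

(* Main.v *)
Require Import Defs.
From HB Require Import structures.
From mathcomp Require Import all_boot all_order all_algebra.
From mathcomp Require Import reals ring.

Set Implicit Arguments.
Unset Strict Implicit.
Unset Printing Implicit Defensive.

Import Order.TTheory GRing.Theory Num.Theory.
Local Open Scope ring_scope.

(** Let L be the linear functional on polynomials with L(X^n) = mu_n. The
    Cholesky factorization G_n = S^-1 H S^-T says S G_n S^T = H, so the rows of
    S_n are the coefficient vectors of monic polynomials P_0, ..., P_n
    orthogonal for L ([cholesky_orthpoly]). The matrix N represents
    differentiation, so that s1 is the coefficient vector of
    Q_j = P_(j+1)' / (j + 1), and the bilinear form attached to sigma is
    (p, q) |-> L(phi p q) with phi = a X^2 + b X + c. The theorem thus says that
    L is classical if and only if the derivatives of its orthogonal polynomials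
    are orthogonal for some functional phi L.

    The recurrence satisfied by mu is the Pearson equation
    L(phi p' + psi p) = 0, with psi = d X + e, tested on the monomials p = X^n
    ([pearsonP]). Applied to a product p q, the Pearson equation is an
    integration by parts; together with orthogonality it gives
<<
      L(phi P_(n+1)' q) = - (n a + d) q_n L(P_(n+1) X^(n+1))
>>
    for deg q <= n ([mom_deriv_orthpoly]). Hence the Q_j are orthogonal for
    phi L, with nonzero norms exactly when n a + d never vanishes
    ([hankel_form_s1]).

    Conversely, suppose the Q_j are orthogonal for phi L. Since Q_0 = 1, the
    functional p |-> L(phi p') vanishes on P_0 and on all P_j with j >= 2. So
    does p |-> L(P_1 p), which does not vanish on P_1; the two functionals are
    therefore proportional, which is the Pearson equation with psi a multiple of
    P_1. The formula above then turns the nonvanishing of the norms of the Q_n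
    into n a + d != 0. *)

(** * The moment functional *)

(** The linear functional sending X^n to mu_n. *)
Definition mom (R : realType) (mu : nat -> R) (p : {poly R}) : R :=
  \sum_(i < size p) p`_i * mu i.

(** Any bound on the size of [p] may serve as the range of the sum. *)
Lemma mom_wide (R : realType) (mu : nat -> R) (N : nat) (p : {poly R}) :
  (size p <= N)%N -> mom mu p = \sum_(i < N) p`_i * mu i.
Proof.
move=> le_pN; rewrite /mom (big_ord_widen _ (fun i => p`_i * mu i) le_pN).
rewrite big_mkcond; apply: eq_bigr => i _.
by case: ltnP => // le_pi; rewrite nth_default // mul0r.
Qed.

Lemma mom_is_scalar (R : realType) (mu : nat -> R) : scalar (mom mu).
Proof.
move=> k p q; pose N := maxn (size (k *: p + q)) (maxn (size p) (size q)).
have le_pN : (size p <= N)%N by rewrite !leq_max leqnn orbT.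
have le_qN : (size q <= N)%N by rewrite !leq_max leqnn !orbT.
rewrite (mom_wide _ le_pN) (mom_wide _ le_qN) (@mom_wide _ _ N) ?leq_maxl //.
rewrite mulr_sumr -big_split; apply: eq_bigr => i _ /=.
by rewrite coefD coefZ mulrDl mulrA.
Qed.

HB.instance Definition _ (R : realType) (mu : nat -> R) :=
  GRing.isLinear.Build R {poly R} R *%R (mom mu) (mom_is_scalar mu).

Lemma momXn (R : realType) (mu : nat -> R) (n : nat) : mom mu 'X^n = mu n.
Proof.
rewrite /mom size_polyXn big_ord_recr /= coefXn eqxx mul1r.
rewrite big1 ?add0r // => i _.
by rewrite coefXn (ltn_eqF (ltn_ord i)) mul0r.
Qed.

(** A linear functional vanishing on polynomials of degrees 0, ..., N - 1
    vanishes on every polynomial of degree less than N. *)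
Lemma scalar_eq0 (R : realType) (f : {poly R} -> R) (N : nat)
    (P : 'I_N -> {poly R}) (p : {poly R}) :
    scalar f -> (forall i, size (P i) = i.+1) -> (forall i, f (P i) = 0) ->
  (size p <= N)%N -> f p = 0.
Proof.
move=> f_lin sizeP fP0 le_pN.
have [n le_pn] := ubnP (size p); elim: n => // n IHn in p le_pn le_pN *.
have f0 : f 0 = 0.
  by have := f_lin (-1) 0 0; rewrite scaler0 addr0 mulN1r addNr.
have [-> // | p_neq0] := eqVneq p 0.
have lt_iN : ((size p).-1 < N)%N by rewrite prednK ?size_poly_gt0.
pose i := Ordinal lt_iN; have sPi : size (P i) = size p.
  by rewrite sizeP prednK ?size_poly_gt0.
have Pi_neq0 : P i != 0 by rewrite -size_poly_eq0 sizeP.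
have lc_neq0 : lead_coef (P i) != 0 by rewrite lead_coef_eq0.
(* Subtracting a multiple of the P_i of the same degree cancels the leading
   term of p. *)
pose k := lead_coef p / lead_coef (P i).
have -> : p = k *: P i + (p - k *: P i) by rewrite addrC subrK.
have lt_r : (size (p - k *: P i)%R < size p)%N.
  rewrite -[ltnRHS]prednK ?size_poly_gt0 // ltnS.
  apply/leq_sizeP => j; rewrite leq_eqVlt => /predU1P[<-|lt_pj].
    by rewrite coefB coefZ -{2}sPi /k -!lead_coefE divfK ?subrr.
  have le_pj : (size p <= j)%N
    by rewrite -(prednK (_ : 0 < size p)%N) ?size_poly_gt0.
  by rewrite coefB coefZ !nth_default ?sPi // mulr0 subrr.
rewrite f_lin fP0 mulr0 add0r IHn //.
  exact: leq_trans lt_r le_pn.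
exact: leq_trans (ltnW lt_r) le_pN.
Qed.

(** * Orthogonal polynomials *)

(** [p] is the monic orthogonal polynomial of degree [n] of the functional
    [mom mu]: it is orthogonal to the lower powers of X, but not to X^n. *)
Definition is_orthpoly (R : realType) (mu : nat -> R) (n : nat)
    (p : {poly R}) : Prop :=
  [/\ p \is monic, size p = n.+1,
      forall k, (k < n)%N -> mom mu (p * 'X^k) = 0
    & mom mu (p * 'X^n) != 0].

(** Against a polynomial of degree at most [n], an orthogonal polynomial of
    degree [n] only sees the coefficient of X^n. *)
Lemma mom_orthpoly (R : realType) (mu : nat -> R) (n : nat) (p q : {poly R}) :
  is_orthpoly mu n p -> (size q <= n.+1)%N ->
  mom mu (p * q) = q`_n * mom mu (p * 'X^n).
Proof.
move=> [_ _ orth _] le_qn; rewrite -[q in LHS]coefK poly_def mulr_sumr.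
rewrite linear_sum /=.
transitivity (\sum_(i < n.+1) q`_i * mom mu (p * 'X^i)).
  rewrite (big_ord_widen _ (fun i => mom mu (p * (q`_i *: 'X^i))) le_qn).
  rewrite big_mkcond; apply: eq_bigr => i _; case: ltnP => le_qi.
    by rewrite -scalerAr linearZ.
  by rewrite nth_default ?mul0r.
rewrite big_ord_recr /= big1 ?add0r // => i _.
by rewrite orth ?mulr0.
Qed.

(** * The Pearson equation *)

(** The polynomial by which L is multiplied to get the functional with moments
    sigma_n. *)
Definition phi (R : realType) (a b c : R) : {poly R} :=
  a *: 'X^2 + b *: 'X + c%:P.

(** The polynomial of degree at most 1 of the Pearson equation. *)
Definition psi (R : realType) (d e : R) : {poly R} := d *: 'X + e%:P.

(** The Pearson equation D(phi L) = psi L, where L is [mom mu] and the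
    derivative of a functional is defined by (D M)(p) = - M(p'). *)
Definition pearson (R : realType) (mu : nat -> R) (a b c d e : R) :=
  forall p : {poly R}, mom mu (phi a b c * p^`() + psi d e * p) = 0.

Lemma pearsonXn (R : realType) (mu : nat -> R) (a b c d e : R) (n : nat) :
  mom mu (phi a b c * ('X^n)^`() + psi d e * 'X^n) =
  (n%:R * a + d) * mu n.+1 + (n%:R * b + e) * mu n + n%:R * c * pred_term mu n.
Proof.
rewrite derivXn /phi /psi.
transitivity (mom mu ((n%:R * a + d) *: 'X^(n.+1) + (n%:R * b + e) *: 'X^n
                      + (n%:R * c) *: ('X^(n.-1) *+ (0 < n)))).
  congr mom; case: n => [|n] /=.
    by rewrite !mulr0n !mulr0 expr0 expr1 !mul0r scale0r !add0r addr0 mulr1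
               alg_polyC.
  rewrite mulr1n -['X^n *+ _]mulr_natl -!mul_polyC !polyCD !polyCM !exprS.
  rewrite polyC_natr.
  ring.
rewrite !linearD !linearZ /= !momXn; congr (_ + _ * _).
by case: n => [|n]; rewrite ?mulr0n ?linear0 ?mulr1n ?momXn.
Qed.

Lemma pearson_scalar (R : realType) (mu : nat -> R) (a b c d e : R) :
  scalar (fun p => mom mu (phi a b c * p^`() + psi d e * p)).
Proof.
move=> k p q; rewrite -mom_is_scalar; congr mom.
by rewrite derivD derivZ -!mul_polyC; ring.
Qed.

(** The Pearson equation amounts to the recurrence of pre-classical sequences,
    which is its instance on monomials. *)
Lemma pearsonP (R : realType) (mu : nat -> R) (a b c d e : R) :
  pearson mu a b c d e <->
  forall n, (n%:R * a + d) * mu n.+1 + (n%:R * b + e) * mu n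
            + n%:R * c * pred_term mu n = 0.
Proof.
split=> [H n | H p]; first by rewrite -pearsonXn H.
apply: (scalar_eq0 (P := fun i : 'I_(size p) => 'X^i)
          (pearson_scalar mu a b c d e)) => // i.
  by rewrite size_polyXn.
by rewrite pearsonXn H.
Qed.

Lemma size_phi (R : realType) (a b c : R) : (size (phi a b c) <= 3)%N.
Proof.
apply/leq_sizeP => j; rewrite /phi !coefD !coefZ coefXn coefX coefC.
by case: j => [|[|[|j]]] // _; rewrite !mulr0 !addr0.
Qed.

Lemma size_psi (R : realType) (d e : R) : (size (psi d e) <= 2)%N.
Proof.
apply/leq_sizeP => j; rewrite /psi !coefD !coefZ coefX coefC.
by case: j => [|[|j]] // _; rewrite !mulr0 !addr0.
Qed.

(** Integration by parts: phi p' q = phi (p q)' - phi p q', and the Pearson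
    equation turns L(phi (p q)') into - L(psi p q). What remains is L applied to
    the product of [p] and a polynomial of degree at most n + 1, whose
    coefficient of X^(n+1) is (n a + d) q_n. *)
Lemma mom_deriv_orthpoly (R : realType) (mu : nat -> R) (a b c d e : R)
    (n : nat) (p q : {poly R}) :
    pearson mu a b c d e -> is_orthpoly mu n.+1 p -> (size q <= n.+1)%N ->
  mom mu (phi a b c * (p^`() * q))
  = - ((n%:R * a + d) * q`_n) * mom mu (p * 'X^(n.+1)).
Proof.
move=> Hpe orth_p le_qn.
have -> : phi a b c * (p^`() * q) =
    (phi a b c * (p * q)^`() + psi d e * (p * q))
    - p * (psi d e * q + phi a b c * q^`()) by rewrite derivM; ring.
rewrite linearB /= Hpe sub0r (mom_orthpoly orth_p).
  rewrite mulNr; congr (- (_ * _)).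
  have q_n1 : q`_n.+1 = 0 by rewrite nth_default.
  have q_n2 : q`_n.+2 = 0 by rewrite nth_default // ltnW.
  rewrite /phi /psi !mulrDl -!scalerAl !coefD !coefZ !mul_polyC !coefZ.
  rewrite coefXM coefXnM coefXM !coef_deriv q_n1 q_n2 /= !mul0rn !subSS.
  case: n {orth_p le_qn q_n1 q_n2} => [|n]; first by rewrite /=; ring.
  by rewrite subn1 -[X in a * X]mulr_natl; ring.
rewrite (leq_trans (size_polyD _ _)) // geq_max.
have bound k (f g : {poly R}) : (size f <= k.+1)%N -> (size g + k <= n.+2)%N ->
    (size (f * g)%R <= n.+2)%N.
  move=> le_f le_g; apply: leq_trans (size_polyMleq _ _) _.
  apply: leq_trans le_g; rewrite addnC -subn1 leq_subLR addnCA add1n.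
  by rewrite leq_add2l.
rewrite (bound 1%N) ?size_psi ?addn1 ?ltnS //=; apply: (bound 2%N).
  exact: size_phi.
rewrite addn2 !ltnS; have [-> | q_neq0] := eqVneq q 0.
  by rewrite deriv0 size_poly0.
by rewrite -ltnS (leq_trans (lt_size_deriv q_neq0)).
Qed.

(** The moments sigma_n are those of the functional p |-> L(phi p). *)
Lemma mom_phi (R : realType) (mu : nat -> R) (a b c : R) (p : {poly R}) :
  mom (fun k => a * mu k.+2 + b * mu k.+1 + c * mu k) p
  = mom mu (phi a b c * p).
Proof.
set sigma := fun k => _; apply/eqP; rewrite -subr_eq0; apply/eqP.
apply: (@scalar_eq0 _ (fun p => mom sigma p - mom mu (phi a b c * p)) (size p)
  (fun i => 'X^i)) => // [k f g | i | i].
- by rewrite mulrDr -scalerAr !mom_is_scalar; ring.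
- by rewrite size_polyXn.
rewrite /phi !mulrDl -!scalerAl mul_polyC -exprD -exprS.
by rewrite !linearD !linearZ /= !momXn subrr.
Qed.

(** * Coefficient vectors *)

Lemma mom_rVpolyM (R : realType) (mu : nat -> R) (m : nat) (u v : 'rV[R]_m) :
  mom mu (rVpoly u * rVpoly v)
  = \sum_(j < m) \sum_(i < m) u 0 i * mu (i + j)%N * v 0 j.
Proof.
have rVpoly_sum (w : 'rV[R]_m) : rVpoly w = \sum_(i < m) w 0 i *: 'X^i.
  by rewrite /rVpoly poly_def; apply: eq_bigr => i _; rewrite valK.
rewrite !rVpoly_sum mulr_sumr linear_sum; apply: eq_bigr => j _ /=.
rewrite mulr_suml linear_sum; apply: eq_bigr => i _ /=.
by rewrite -scalerAl -scalerAr -exprD !linearZ /= momXn; ring.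
Qed.

(** The polynomial whose coefficients are the entries of a column vector. *)
Definition cVpoly (R : realType) (m : nat) (v : 'cV[R]_m) : {poly R} :=
  rVpoly v^T.

Lemma hankel_formE (R : realType) (mu : nat -> R) (n : nat)
    (u v : 'cV[R]_n.+1) :
  hankel_form mu u v = mom mu (cVpoly u * cVpoly v).
Proof.
rewrite /cVpoly mom_rVpolyM /hankel_form mxE; apply: eq_bigr => j _.
by rewrite !mxE mulr_suml; apply: eq_bigr => i _; rewrite !mxE.
Qed.

(** The matrix N represents differentiation. *)
Lemma cVpoly_Nmx (R : realType) (n : nat) (v : 'cV[R]_n.+1) :
  cVpoly (Nmx R n *m v) = (cVpoly v)^`().
Proof.
apply/polyP => k; rewrite coef_deriv !coef_rVpoly.
case: insubP => [i _ <- | ].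
  have lt_i1 : (i.+1 < n.+1)%N by rewrite ltnS.
  rewrite insubT !mxE (bigD1 (Ordinal lt_i1)) //= big1 ?addr0.
    by rewrite !mxE eqxx mulr_natl.
  move=> l; rewrite -val_eqE /= => /negPf neq_l.
  by rewrite mxE neq_l mul0r.
by move=> le_nk; rewrite insubN ?mul0rn // ltnS.
Qed.

(** The rows of the Cholesky factor are the coefficient vectors of the monic
    orthogonal polynomials, because S G S^T = H expresses
    L(P_i P_k) = H_(i,k). *)
Lemma cholesky_orthpoly (R : realType) (mu : nat -> R) (n : nat)
    (S H : 'M[R]_n.+1) (j : 'I_n.+1) :
  cholesky (hankel mu n) S H -> is_orthpoly mu j (rVpoly (row j S)).
Proof.
move=> [[S_trig S_diag] H_diag H_unit GE].
have S_unit : S \in unitmx.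
  by rewrite unitmxE det_trig // big1 ?unitr1.
have momH i k : mom mu (rVpoly (row i S) * rVpoly (row k S)) = H i k.
  have <- : S *m hankel mu n *m S^T = H.
    rewrite GE !mulmxA mulmxV // mul1mx -mulmxA -trmx_mul mulmxV //.
    by rewrite trmx1 mulmx1.
  rewrite mom_rVpolyM mxE; apply: eq_bigr => l _.
  by rewrite !mxE mulr_suml; apply: eq_bigr => r _; rewrite !mxE.
have H_neq0 i : H i i != 0.
  move: H_unit; rewrite unitmxE det_trig ?is_diag_mx_is_trig // unitfE.
  by rewrite prodf_seq_neq0 => /allP/(_ i); rewrite mem_index_enum => /(_ isT).
have coefS (i : 'I_n.+1) k : (i < k)%N -> (rVpoly (row i S))`_k = 0.
  move=> lt_ik; rewrite coef_rVpoly; case: insubP => // l _ kE.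
  by rewrite mxE (is_trig_mxP S_trig) ?kE.
have coefSd (i : 'I_n.+1) : (rVpoly (row i S))`_i = 1.
  by rewrite coef_rVpoly_ord mxE S_diag.
have sizeS (i : 'I_n.+1) : size (rVpoly (row i S)) = i.+1.
  apply/eqP; rewrite eqn_leq; apply/andP; split.
    by apply/leq_sizeP => k; apply: coefS.
  rewrite ltnNge; apply/negP => /leq_sizeP/(_ i (leqnn i)).
  by rewrite coefSd => /eqP; rewrite oner_eq0.
have orth (p : {poly R}) : (size p <= j)%N -> mom mu (rVpoly (row j S) * p) = 0.
  pose lt_j (i : 'I_j) := ltn_trans (ltn_ord i) (ltn_ord j).
  apply: (@scalar_eq0 _ (fun p => mom mu (rVpoly (row j S) * p)) j
            (fun i => rVpoly (row (Ordinal (lt_j i)) S))).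
  - by move=> k f g; rewrite mulrDr -scalerAr mom_is_scalar.
  - by move=> i; rewrite sizeS.
  move=> i; rewrite momH (is_diag_mxP H_diag) //= neq_ltn.
  by rewrite ltn_ord orbT.
split=> //.
- by rewrite monicE lead_coefE sizeS coefSd.
- by move=> k lt_kj; rewrite orth // size_polyXn.
suff -> : mom mu (rVpoly (row j S) * 'X^j) = H j j by [].
rewrite -momH -[RHS]addr0 -(orth ('X^j - rVpoly (row j S))).
  by rewrite -linearD -mulrDr addrC subrK.
apply/leq_sizeP => k; rewrite leq_eqVlt => /predU1P[<- | lt_jk].
  by rewrite coefB coefXn eqxx coefSd subrr.
by rewrite coefB coefXn (gtn_eqF lt_jk) coefS ?subrr.
Qed.

(** Pairwise orthogonal vectors of nonzero norm form a basis, provided that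
    there are as many of them as the dimension. *)
Lemma orthogonal_basis_hankel (R : realType) (sigma : nat -> R) (n : nat)
    (w : 'I_n.+1 -> 'cV[R]_n.+1) :
    (forall i j, i != j -> hankel_form sigma (w i) (w j) = 0) ->
    (forall i, hankel_form sigma (w i) (w i) != 0) ->
  orthogonal_basis (@hankel_form R sigma n) w.
Proof.
move=> w_orth w_neq0; split=> //; rewrite basisEfree; apply/and3P; split.
- apply/freeP => k sum0 i; apply/eqP.
  have : hankel_form sigma (\sum_i k i *: [tuple w i | i < n.+1]`_i) (w i) = 0.
    by rewrite sum0 /hankel_form trmx0 !mul0mx mxE.
  rewrite /hankel_form linear_sum !mulmx_suml summxE (bigD1 i) //= big1.
    rewrite addr0 (nth_map i) ?size_enum_ord // nth_ord_enum linearZ.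
    rewrite -!scalemxAl mxE => /eqP.
    by rewrite mulf_eq0 (negPf (w_neq0 i)) orbF.
  move=> l l_neq_i; rewrite (nth_map i) ?size_enum_ord // nth_ord_enum linearZ.
  by rewrite -!scalemxAl mxE [X in _ * X]w_orth ?mulr0.
- exact: subvf.
by rewrite size_tuple dimvf dim_matrix [leqLHS]muln1.
Qed.

(** * Derivatives of orthogonal polynomials *)

(** P_(n+1)' / (n + 1) is monic of degree n. *)
Lemma coef_orthpoly_deriv (R : realType) (mu : nat -> R) (n : nat)
    (p : {poly R}) :
  is_orthpoly mu n.+1 p ->
  (size (n.+1%:R^-1 *: p^`()) <= n.+1)%N /\ (n.+1%:R^-1 *: p^`())`_n = 1.
Proof.
move=> [p_monic size_p _ _]; split.
  apply: leq_trans (size_scale_leq _ _) _.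
  rewrite -ltnS -size_p lt_size_deriv //.
  by rewrite -size_poly_eq0 size_p.
have p_lead : p`_n.+1 = 1.
  by move: p_monic; rewrite monicE lead_coefE size_p => /eqP.
by rewrite coefZ coef_deriv p_lead mulVf // pnatr_eq0.
Qed.

Lemma orthpoly1E (R : realType) (mu : nat -> R) (p : {poly R}) :
  mu 0%N != 0 -> is_orthpoly mu 1 p -> p = psi 1 (- (mu 1%N / mu 0%N)).
Proof.
move=> mu0_neq0 [p_monic size_p orth _].
have p1 : p`_1 = 1 by move: p_monic; rewrite monicE lead_coefE size_p => /eqP.
have pE : p = psi 1 p`_0.
  rewrite -[LHS]coefK size_p poly_def big_ord_recl big_ord1 /= p1 addrC expr0.
  by rewrite alg_polyC expr1.
have mom0 : mu 1%N + p`_0 * mu 0%N = 0.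
  have : mom mu (psi 1 p`_0) = 0 by rewrite -pE -(orth 0%N isT) expr0 mulr1.
  rewrite /psi -alg_polyC -['X]expr1 -(expr0 'X) linearD !linearZ /= !momXn.
  by rewrite mul1r.
have -> : mu 1%N = - (p`_0 * mu 0%N) by apply/eqP; rewrite -addr_eq0 mom0.
by rewrite mulNr opprK mulfK.
Qed.

Lemma cVpoly_s1 (R : realType) (S : forall n, 'M[R]_n.+1) (n : nat)
    (j : 'I_n.+1) :
  cVpoly (s1 S j) = j.+1%:R^-1 *: (rVpoly (row (lift ord0 j) (S n.+1)))^`().
Proof.
by rewrite /s1 /cVpoly !linearZ /= -/(cVpoly _) cVpoly_Nmx /cVpoly tr_col trmxK.
Qed.

(** Under the Pearson equation the derivatives are orthogonal for phi L, and
    this is the value of their norms; for i < j the coefficient of X^j in Q_i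
    vanishes. *)
Lemma hankel_form_s1 (R : realType) (mu : nat -> R) (S H : forall n, 'M[R]_n.+1)
    (a b c d e : R) (n : nat) (i j : 'I_n.+1) :
    (forall n, cholesky (hankel mu n) (S n) (H n)) ->
    pearson mu a b c d e -> (i <= j)%N ->
  hankel_form (fun k => a * mu k.+2 + b * mu k.+1 + c * mu k) (s1 S i) (s1 S j)
  = - (j.+1%:R^-1 * (j%:R * a + d)
       * mom mu (rVpoly (row (lift ord0 j) (S n.+1)) * 'X^(j.+1))) *+ (i == j).
Proof.
move=> hchol Hpe le_ij.
have orthS (l : 'I_n.+1) := cholesky_orthpoly (lift ord0 l) (hchol n.+1).
rewrite hankel_formE mom_phi !cVpoly_s1.
have [] := coef_orthpoly_deriv (orthS i).
set q := _ *: _ => size_q coef_q.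
rewrite [q * _]mulrC -scalerAl -scalerAr linearZ /=.
rewrite (mom_deriv_orthpoly Hpe (orthS j)) ?(leq_trans size_q) //.
have [<- | neq_ij] := eqVneq i j; first by rewrite coef_q mulr1n; ring.
rewrite nth_default ?mulr0n; first by ring.
by apply: leq_trans size_q _; rewrite ltn_neqAle neq_ij.
Qed.

Theorem theorem5p8 (R : realType) (mu : nat -> R)
    (S H : forall n : nat, 'M[R]_n.+1)
    (hdet : forall n : nat, \det (hankel mu n) != 0)
    (hchol : forall n : nat, cholesky (hankel mu n) (S n) (H n)) :
  classical mu <->
  exists a b c : R,
    0 < `|a| + `|b| + `|c| /\
    forall n : nat,
      orthogonal_basis
        (@hankel_form R (fun k : nat => a * mu k.+2 + b * mu k.+1 + c * mu k) n)
        (@s1 R S n).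
Proof.
have orthS n (j : 'I_n.+1) := cholesky_orthpoly j (hchol n).
split=> [[[_ [a [b [c [d [e [abc_gt0 ad_neq0 rec]]]]]]] _] | ].
  have Hpe : pearson mu a b c d e by apply/pearsonP.
  exists a, b, c; split=> // n; apply: orthogonal_basis_hankel => [i j | i].
    wlog le_ij : i j / (i <= j)%N => [IH | neq_ij].
      case/orP: (leq_total i j) => le_ij neq_ij; first exact: IH.
      by rewrite hankel_formE mulrC -hankel_formE IH // eq_sym.
    by rewrite (hankel_form_s1 hchol Hpe) // (negPf neq_ij).
  rewrite (hankel_form_s1 hchol Hpe) // eqxx mulr1n oppr_eq0 !mulf_neq0 //.
    by rewrite invr_eq0 pnatr_eq0.
  by case: (orthS n.+1 (lift ord0 i)).
move=> [a [b [c [abc_gt0 basis]]]].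
have mu0_neq0 : mu 0%N != 0 by have := hdet 0%N; rewrite det_mx11 mxE.
split=> //; split=> //.
(* psi is the multiple d P_1 for which L(psi P_1) = - L(phi). *)
pose sigma k := a * mu k.+2 + b * mu k.+1 + c * mu k.
pose p1 := psi 1 (- (mu 1%N / mu 0%N)).
have orth_p1 : is_orthpoly mu 1 p1.
  have := orthS 1%N (lift ord0 ord0).
  by move=> orth; rewrite /p1 -(orthpoly1E mu0_neq0 orth).
have h1_neq0 : mom mu (p1 * 'X) != 0 by case: orth_p1; rewrite expr1.
pose d := - (sigma 0%N / mom mu (p1 * 'X)).
pose e := - (d * (mu 1%N / mu 0%N)).
have psiE : psi d e = d *: p1.
  by rewrite /p1 /psi scalerDr scalerA mulr1 -!mul_polyC -polyCM mulrN.
have Hpe : pearson mu a b c d e.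
  (* Tested on the basis P_0, ..., P_(N+1) given by the rows of S_(N+1). *)
  move=> p; pose N := size p.
  apply: (scalar_eq0 (P := fun j : 'I_N.+2 => rVpoly (row j (S N.+1)))
            (pearson_scalar mu a b c d e)) => [j | j | ]; last exact: ltnW.
    by case: (orthS N.+1 j).
  have := orthS N.+1 j; set q := rVpoly _ => orth_q.
  rewrite linearD /= psiE -scalerAl linearZ /=.
  have [j0 | [j' jE]] : j = ord0 \/ exists j', j = lift ord0 j'.
    by case: (unliftP ord0 j) => [j' ->|->]; [right; exists j' | left].
    have size_q : size q = 1%N by case: orth_q => _ ->; rewrite j0.
    have [k ->] : exists k, q = k%:P.
      by exists q`_0; apply: size1_polyC; rewrite size_q.
    rewrite derivC mulr0 linear0 add0r (mom_orthpoly orth_p1).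
      by rewrite coefC mul0r mulr0.
    by rewrite (leq_trans (size_polyC_leq1 _)).
  have lift0 k : lift ord0 k = k.+1 :> nat by [].
  have deriv_p1 : p1^`() = 1.
    by rewrite /p1 /psi scale1r derivD derivX derivC addr0.
  have [j'0 | j'_gt0] := posnP j'.
    have -> : q = p1.
      by apply: orthpoly1E mu0_neq0 _; move: orth_q; rewrite jE lift0 j'0.
    rewrite deriv_p1 -mom_phi -(expr0 'X) momXn (mom_orthpoly orth_p1).
      have -> : p1`_1 = 1.
        case: orth_p1 => + size_p1.
        by rewrite monicE lead_coefE size_p1 => /eqP.
      by rewrite mul1r expr1 /d mulNr divfK ?subrr.
    by case: orth_p1 => _ ->.
  rewrite [p1 * q]mulrC (mom_orthpoly orth_q); last first.
    by case: orth_p1 => _ -> _ _; rewrite jE lift0.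
  rewrite nth_default ?mul0r ?mulr0 ?addr0; last first.
    by case: orth_p1 => _ -> _ _; rewrite jE lift0.
  (* For j >= 2, L(phi P_j') is a multiple of the form evaluated at Q_0 = 1
     and Q_(j-1). *)
  have [_ /(_ ord0 j') + _] := basis N.
  rewrite -val_eqE /= ltn_eqF // hankel_formE mom_phi => /(_ isT).
  rewrite !cVpoly_s1 -jE -/q.
  have -> : rVpoly (row (lift ord0 ord0) (S N.+1)) = p1.
    exact: orthpoly1E mu0_neq0 (orthS N.+1 (lift ord0 ord0)).
  rewrite deriv_p1 invr1 scale1r mul1r -scalerAr linearZ /= => /eqP.
  by rewrite mulf_eq0 invr_eq0 pnatr_eq0 => /eqP.
exists a, b, c, d, e; split=> // [n | ]; last by apply/pearsonP.
(* n a + d is a factor of the norm of Q_n, the last vector of the basis. *)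
have [_ _ /(_ ord_max)] := basis n.
rewrite (hankel_form_s1 hchol Hpe) // eqxx mulr1n oppr_eq0 !mulf_eq0 !negb_or.
by case/andP=> /andP[].
Qed.
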